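(* Let $n\ge1$ and let $B_1,\ldots,B_n$ be independent standard one-dimensional Brownian motions, each starting from $0$. Define $$Z_1(t)=B_1(t),\qquad Z_j(t)=\sup_{0\le s\le t}\big(Z_{j-1}(s)+B_j(t)-B_j(s)\big),\quad 2\le j\le n,$$ and $$Y_1(t)=B_1(t)-\inf_{0\le s\le t}B_1(s)=\sup_{0\le s\le t}(B_1(t)-B_1(s)),\qquad Y_j(t)=\sup_{0\le s\le t}\big(Y_{j-1}(s)+B_j(t)-B_j(s)\big),\quad 2\le j\le n.$$ Then for each fixed $t\ge 0$, $$\sup_{0\le s\le t}Z_n(s)\overset{d}{=}Y_n(t),$$ where $\overset{d}{=}$ denotes equality in law of random variables. *)

(* Defs.v *)
From HB Require Import structures.
From mathcomp Require Import all_boot all_order all_algebra.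
From mathcomp Require Import finmap.
From mathcomp Require Import all_classical all_reals all_analysis.

Set Implicit Arguments.
Unset Strict Implicit.
Unset Printing Implicit Defensive.

Import Order.TTheory GRing.Theory Num.Theory.
Import numFieldNormedType.Exports.

Local Open Scope classical_set_scope.
Local Open Scope ring_scope.

Definition mutually_independent (d : measure_display) (T : measurableType d)
    (R : realType) (P : probability T R) (I : choiceType) (D : set I)
    (F : I -> set (set T)) :=
  forall (J : {fset I}) (A : I -> set T), [set` J] `<=` D ->
    (forall j, j \in J -> F j (A j)) ->
    P (\bigcap_(j in [set` J]) A j) = (\prod_(j <- J) P (A j))%E.

Definition sigma_rv (d : measure_display) (T : measurableType d)
    (R : realType) (X : T -> R) : set (set T) :=
  preimage_set_system setT X measurable.

(* Time is the half-line [0, +oo[; the values of X at negative times are not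
   used. *)
Definition sigma_process (d : measure_display) (T : measurableType d)
    (R : realType) (X : R -> T -> R) : set (set T) :=
  <<s \bigcup_(t in `[0, +oo[) sigma_rv (X t) >>.

(* The second parameter of normal_prob is the standard deviation. *)
Record standard_brownian_motion (d : measure_display) (T : measurableType d)
    (R : realType) (P : probability T R) (X : R -> {RV P >-> R}) : Prop := {
  bm_start : forall w, X 0 w = 0 ;
  bm_continuous : forall w, {within `[0, +oo[, continuous (fun t => X t w)} ;
  bm_gaussian_increments : forall s t, 0 <= s -> s < t ->
    forall A : set R, measurable A ->
    P ((fun w => X t w - X s w) @^-1` A) = normal_prob 0 (Num.sqrt (t - s)) A ;
  bm_independent_increments : forall (k : nat) (t : nat -> R), 0 <= t 0%N ->
    (forall i, (i < k)%N -> t i < t i.+1) ->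
    mutually_independent P `I_k
      (fun i => sigma_rv (fun w => X (t i.+1) w - X (t i) w)) }.

Definition queue_step (R : realType) (f b : R -> R) (t : R) : R :=
  sup [set f s + b t - b s | s in `[0, t]].

(* [iterated_queue f b j] is f for j = 1 and then applies [queue_step] with the
   drivers b 2, ..., b j in turn. Indices start at 1; j = 0 is a dummy value. *)
Fixpoint iterated_queue (R : realType) (f : R -> R) (b : nat -> R -> R)
    (j : nat) : R -> R :=
  if j is i.+1 then
    if i is 0 then f else queue_step (iterated_queue f b i) (b j)
  else f.

Definition Zpath (R : realType) (b : nat -> R -> R) : nat -> R -> R :=
  iterated_queue (b 1%N) b.

Definition Y1path (R : realType) (b1 : R -> R) (t : R) : R :=
  b1 t - inf [set b1 s | s in `[0, t]].

Definition Ypath (R : realType) (b : nat -> R -> R) : nat -> R -> R :=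
  iterated_queue (Y1path (b 1%N)) b.

Lemma Y1path_sup (R : realType) (b1 : R -> R) (t : R) : 0 <= t ->
  {within `[0, +oo[, continuous b1} ->
  Y1path b1 t = sup [set b1 t - b1 s | s in `[0, t]].
Proof.
move=> t0 cb.
have cb0t : {within `[0, t], continuous b1}.
  apply: continuous_subspaceW cb => x /=.
  by rewrite !in_itv /= => /andP[-> _].
have [c c0t bc] := EVT_min t0 cb0t.
have cS : `[0, t]%classic c by [].
rewrite /Y1path.
have -> : inf [set b1 s | s in `[0, t]] = b1 c.
  apply/eqP; rewrite eq_le; apply/andP; split.
    by apply: ge_inf; [exists (b1 c) => _ [s /= /bc ? <-] | exists c].
  by apply: lb_le_inf; [exists (b1 c), c | move=> _ [s /= /bc ? <-]].
apply/eqP; rewrite eq_le; apply/andP; split.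
  apply: ub_le_sup; last by exists c.
  by exists (b1 t - b1 c) => _ [s /= /bc ? <-]; rewrite lerD2l lerN2.
apply: ge_sup; first by exists (b1 t - b1 c), c.
by move=> _ [s /= /bc ? <-]; rewrite lerD2l lerN2.
Qed.

(* The two functions are not assumed measurable: being random variables is part
   of the claim. *)
Definition eq_in_law (d : measure_display) (T : measurableType d)
    (R : realType) (P : probability T R) (X Y : T -> R) : Prop :=
  [/\ measurable_fun setT X, measurable_fun setT Y
    & forall A : set R, measurable A -> pushforward P X A = pushforward P Y A].

(* Main.v *)
Require Import Defs.
From HB Require Import structures.
From mathcomp Require Import all_boot all_order all_algebra.
From mathcomp Require Import finmap.
From mathcomp Require Import all_classical all_reals all_analysis.
From mathcomp Require Import ring lra zify.

Set Implicit Arguments.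
Unset Strict Implicit.
Unset Printing Implicit Defensive.

Import Order.TTheory GRing.Theory Num.Theory.
Import numFieldNormedType.Exports.

Local Open Scope classical_set_scope.
Local Open Scope ring_scope.

(** Unfolding the nested suprema turns both sides into last-passage problems.
    Call [schedule] a sequence 0 <= s_0 <= s_1 <= ... <= s_n <= t and give it
    the weight \sum_(1 <= i <= n) (B_i(s_i) - B_i(s_(i-1))).  The supremum of
    Z_n over [0, t] is the largest weight of a schedule with s_0 = 0
    ([lt_sup_ZpathP]): the last time s_n is left free by the supremum over
    [0, t].  Y_n(t) is the largest weight of a schedule with s_n = t
    ([lt_YpathP]): here it is the first time s_0 which is left free, by the
    supremum (or infimum) in Y_1.  Reversing time and the order of the drivers,
    s_i |-> t - s_(n-i) and B_i |-> B_(n+1-i)(t) - B_(n+1-i)(t - .), exchanges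
    the two problems and preserves the joint law of the drivers on [0, t], which
    gives the claim.

    Invariance of the law under reversal is used only for finitely many
    increments.  On the grid of mesh t / 2 ^ m the increments of the n motions
    are n * 2 ^ m independent variables with one common law, so their joint law
    is determined by its values on rectangles ([grid_law_unique]) and is
    invariant under any reordering; hence the event that some grid schedule from
    0 has weight above a has the same probability as the event that some grid
    schedule up to t has ([prob_exceed]).  By path continuity a schedule of
    weight above a can be replaced by one with times on a fine enough dyadic
    grid and with the same pinned endpoint ([exceed_from_0P], [exceed_to_endP]).
    So { sup Z_n > a } and { Y_n(t) > a } are increasing unions over m of events
    of equal probability; they are measurable and equiprobable, and the half
    lines ]a, +oo[ determine a law on the reals ([eq_law_of_gt]). *)

(** * Determining a law from fewer events *)

(** Uniqueness of measures on a pi-system, applied to the two image measures;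
    finiteness is automatic as these are probabilities. *)
Lemma eq_law_of_pi_system d (T : measurableType d) (R : realType)
    (P : probability T R) d' (T' : measurableType d') (G : set (set T'))
    (g : nat -> set T') (X Y : T -> T') :
    measurable = <<s G >> -> setI_closed G ->
    (forall k, G (g k)) -> \bigcup_k g k = setT ->
    measurable_fun setT X -> measurable_fun setT Y ->
    (forall A, G A -> P (X @^-1` A) = P (Y @^-1` A)) ->
  forall A, measurable A -> P (X @^-1` A) = P (Y @^-1` A).
Proof.
move=> mG GI Gg gT mX mY XY A mA.
pose iX := isMeasurableFun.Build _ _ _ _ X mX.
pose iY := isMeasurableFun.Build _ _ _ _ Y mY.
pose X' : {mfun T >-> T'} := HB.pack X iX.
pose Y' : {mfun T >-> T'} := HB.pack Y iY.
apply: (measure_unique G g mG GI Gg gT (distribution P X') (distribution P Y'))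
  => // k.
rewrite (le_lt_trans (probability_le1 _ _)) ?ltry// mG.
by apply: sub_sigma_algebra.
Qed.

(** The half lines ]a, +oo[ are stable under intersection and generate the
    Borel sets, so they give both the measurability and the law. *)
Lemma eq_law_of_gt d (T : measurableType d) (R : realType)
    (P : probability T R) (X Y : T -> R) :
    (forall a, measurable [set w | a < X w]) ->
    (forall a, measurable [set w | a < Y w]) ->
    (forall a, P [set w | a < X w] = P [set w | a < Y w]) ->
  eq_in_law P X Y.
Proof.
have preE (Z : T -> R) a : Z @^-1` `]a, +oo[ = [set w | a < Z w].
  by apply/seteqP; split=> w /=; rewrite in_itv/= andbT.
have mR : measurable = <<s measurable_realfun.RGenOInfty.G (R:=R) >> :> set (set R).
  exact: measurable_realfun.RGenOInfty.measurableE.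
have mgt (Z : T -> R) : (forall a, measurable [set w | a < Z w]) ->
    measurable_fun setT Z.
  move=> mZ; apply: (measurability _ mR) => _ [_ [a ->] <-].
  by rewrite setTI preE.
move=> /[dup] /mgt mX _ /[dup] /mgt mY _ XY; split=> //.
move=> A mA; rewrite /pushforward.
apply: (eq_law_of_pi_system (T' := measurableTypeR R)
  (g := fun k => `]- k%:R, +oo[%classic) mR) => //.
- move=> _ _ [a ->] [b ->]; exists (Num.max a b).
  by apply/seteqP; split=> x /=; rewrite !in_itv/= !andbT gt_max => /andP.
- by move=> k; exists (- k%:R).
- apply/seteqP; split=> // x _.
  exists (Num.truncn `|x|).+1 => //=; rewrite in_itv/= andbT ltrNl.
  by apply: le_lt_trans (truncnS_gt _); rewrite -normrN ler_norm.
- by move=> _ [a ->]; rewrite !preE.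
Qed.

(** * Last-passage form of the queueing recursions *)

(** Suprema enter the proof only through their strict upper level sets, because
    an event { sup > a } is a union of events { value > a }. *)
Lemma lt_supP (R : realType) (S : set R) (a : R) : has_sup S ->
  a < sup S <-> exists2 x, S x & a < x.
Proof.
move=> [S0 uS]; split; first exact: sup_gt.
by move=> [x Sx ax]; apply: lt_le_trans ax _; exact: ub_le_sup.
Qed.

Definition ubounded_until (R : realType) (t : R) (f : R -> R) :=
  exists M, forall u, 0 <= u <= t -> f u <= M.

(** Boundedness of the drivers keeps every supremum below away from the default
    value that [sup] takes on unbounded sets. *)
Definition bounded_until (R : realType) (t : R) (f : R -> R) :=
  exists M, forall u, 0 <= u <= t -> `|f u| <= M.

Lemma continuous_bounded_until (R : realType) (f : R -> R) (t : R) : 0 <= t ->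
  {within `[0, +oo[, continuous f} -> bounded_until t f.
Proof.
move=> t0 cf.
have cf0t : {within `[0, t], continuous f}.
  apply: continuous_subspaceW cf => x /=.
  by rewrite !in_itv /= => /andP[-> _].
have [c _ fc] := EVT_max t0 cf0t.
have [c' _ fc'] := EVT_min t0 cf0t.
exists (`|f c| + `|f c'|) => u u0t.
have uI : u \in `[0, t] by rewrite in_itv.
have fu1 := fc _ uI; have fu2 := fc' _ uI.
have h1 := ler_norm (f c); have h2 := ler_norm (- f c').
have h3 := normr_ge0 (f c); have h4 := normr_ge0 (f c').
rewrite normrN in h2; rewrite ler_norml; apply/andP; split; lra.
Qed.

Lemma lt_queue_stepP (R : realType) (t u : R) (f g : R -> R) (a : R) :
    ubounded_until t f -> bounded_until t g -> 0 <= u <= t ->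
  a < queue_step f g u <->
  exists2 s, 0 <= s <= u & a < f s + (g u - g s).
Proof.
move=> [M fM] [K gK] /andP[u0 ut].
have hS : has_sup [set f s + g u - g s | s in `[0, u]].
  split; first by exists (f 0 + g u - g 0), 0 => //=; rewrite in_itv/= lexx.
  exists (M + (K + K)) => x [s /=]; rewrite in_itv/= => /andP[s0 su] <-.
  have fs : f s <= M by apply: fM; rewrite s0 (le_trans su).
  have : `|g s| <= K by apply: gK; rewrite s0 (le_trans su).
  have : `|g u| <= K by apply: gK; rewrite u0.
  by rewrite !ler_norml => /andP[? ?] /andP[? ?]; lra.
rewrite /queue_step; split.
  move/(lt_supP _ hS) => [x [s /=]]; rewrite in_itv/= => su <- ?.
  by exists s => //; rewrite addrA.
move=> [s su ?]; apply/(lt_supP _ hS); exists (f s + g u - g s).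
  by exists s => //=; rewrite in_itv.
by rewrite -addrA.
Qed.

Lemma queue_step_ubounded_until (R : realType) (t : R) (f g : R -> R) :
    ubounded_until t f -> bounded_until t g ->
  ubounded_until t (queue_step f g).
Proof.
move=> bf bg; have [M fM] := bf; have [K gK] := bg.
exists (M + (K + K)) => u ut; rewrite leNgt; apply/negP.
move/(lt_queue_stepP _ bf bg ut) => [s /andP[s0 su]].
have /andP[u0 ut'] := ut.
have fs : f s <= M by apply: fM; rewrite s0 (le_trans su).
have : `|g s| <= K by apply: gK; rewrite s0 (le_trans su).
have : `|g u| <= K by apply: gK; rewrite u0.
by rewrite !ler_norml => /andP[? ?] /andP[? ?]; lra.
Qed.

(** The driver [b i.+1] runs during [s i, s i.+1]: drivers are numbered from 1,
    the times of a schedule from 0. *)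
Definition path_weight (R : realType) (b : nat -> R -> R) (n : nat)
    (s : nat -> R) : R :=
  \sum_(i < n) (b i.+1 (s i.+1) - b i.+1 (s i)).

Definition schedule (R : realType) (t : R) (n : nat) (s : nat -> R) : Prop :=
  [/\ 0 <= s 0%N, forall i, (i < n)%N -> s i <= s i.+1 & s n <= t].

Lemma schedule_itv (R : realType) (t : R) n (s : nat -> R) : schedule t n s ->
  forall i, (i <= n)%N -> 0 <= s i <= t.
Proof.
move=> [s0 sS sn] i le_in; apply/andP; split.
  elim: i le_in => // i IH lt_in.
  exact: le_trans (IH (ltnW lt_in)) (sS _ lt_in).
have H k : (k <= n)%N -> s (n - k)%N <= t.
  elim: k => [|k IH] kn; first by rewrite subn0.
  apply: le_trans (IH (ltnW kn)).
  have -> : (n - k = (n - k.+1).+1)%N by lia.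
  by apply: sS; lia.
by have := H (n - i)%N (leq_subr _ _); rewrite subKn.
Qed.

(** Each queue step splits off the last time of the schedule.  The two conclusions
    are proved together since the description of the next supremum needs that the
    previous one is bounded.  Here [s 0] is the time at which [f] is read, so
    that the drivers in use are b 2, ..., b j.+1. *)
Lemma lt_iterated_queueP (R : realType) (t : R) (f : R -> R)
    (b : nat -> R -> R) (n : nat) :
    ubounded_until t f ->
    (forall i, (1 <= i <= n)%N -> bounded_until t (b i)) ->
  forall j, (j < n)%N ->
  ubounded_until t (iterated_queue f b j.+1) /\
  forall u a, 0 <= u <= t ->
    a < iterated_queue f b j.+1 u <->
    exists2 s : nat -> R, schedule t j s &
      s j = u /\
      a < f (s 0%N) + path_weight (fun i => b i.+1) j s.
Proof.
move=> bf bb; elim=> [|j IH] jn.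
  split=> // u a /andP[u0 ut]; split.
    move=> au; exists (fun=> u); first by split=> // i _; exact: lexx.
    by rewrite /path_weight big_ord0 addr0.
  by move=> [s _ [<-]]; rewrite /path_weight big_ord0 addr0.
have [bq qP] := IH (ltnW jn).
have bj : bounded_until t (b j.+2) by apply: bb; lia.
split; first exact: queue_step_ubounded_until.
move=> u a uI; have /andP[u0 ut] := uI; split.
  move/(lt_queue_stepP _ bq bj uI) => [v /andP[v0 vu]].
  rewrite -ltrBlDr; have vt : v <= t := le_trans vu ut.
  move/qP; rewrite v0 vt => /(_ isT) [s [s0 sS sj] [svj]].
  rewrite ltrBlDr => ha.
  (* the new last time is u *)
  exists (fun i => if (i <= j)%N then s i else u).
    split=> [//|i ij|]; last by rewrite ltnn.
    have ij1 : (i <= j)%N by [].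
    rewrite ij1; case: ltnP => ij'; first exact: sS.
    by have -> : i = j; [lia | rewrite svj].
  rewrite ltnn; split=> //.
  rewrite /path_weight big_ord_recr /= leqnn ltnn svj addrA.
  congr (a < _ + _ + _): ha; apply: eq_bigr => i _.
  by rewrite ltn_ord (ltnW (ltn_ord i)).
move=> [s [s0 sS sj] [sju ha]].
have st := schedule_itv (And3 s0 sS sj).
apply/(lt_queue_stepP _ bq bj uI); exists (s j).
  by rewrite -sju sS// andbT; have /andP[] := st j (leqnSn j).
rewrite -ltrBlDr; apply/qP; first exact: st.
exists s.
  split=> //; last by have /andP[] := st j (leqnSn j).
  by move=> i ij; apply: sS; rewrite ltnS ltnW.
split=> //; rewrite ltrBlDr -addrA -sju.
by move: ha; rewrite /path_weight big_ord_recr.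
Qed.

Lemma path_weight_recl (R : realType) (b : nat -> R -> R) n (s : nat -> R) :
  path_weight b n.+1 s =
  b 1%N (s 1%N) - b 1%N (s 0%N) +
  path_weight (fun i => b i.+1) n (fun i => s i.+1).
Proof. by rewrite /path_weight big_ord_recl. Qed.

(** As b 1 starts at 0, reading Z_1 = b 1 at s_1 amounts to running the driver
    b 1 from the pinned time s_0 = 0; the final supremum frees s_n. *)
Lemma lt_sup_ZpathP (R : realType) (t : R) (b : nat -> R -> R) (n : nat) a :
    (1 <= n)%N -> 0 <= t ->
    (forall i, (1 <= i <= n)%N -> bounded_until t (b i)) -> b 1%N 0 = 0 ->
  a < sup [set Zpath b n s | s in `[0, t]] <->
  exists2 s, schedule t n s & s 0%N = 0 /\ a < path_weight b n s.
Proof.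
case: n => // n _ t0 bb b10.
have bf : ubounded_until t (b 1%N).
  have [M bM] := bb 1%N isT; exists M => u /bM; exact/le_trans/ler_norm.
have [[M ZM] ZP] := lt_iterated_queueP bf bb (ltnSn n).
have hS : has_sup [set Zpath b n.+1 s | s in `[0, t]].
  split; first by exists (Zpath b n.+1 0), 0 => //=; rewrite in_itv/= lexx.
  by exists M => x [s /=]; rewrite in_itv/= => /ZM ? <-.
split.
  move/(lt_supP _ hS) => [x [u /=]]; rewrite in_itv/= => uI <-.
  move/ZP => /(_ uI) [s sc [sn sa]].
  have [s0 sS st] := sc.
  exists (fun i => if i is i'.+1 then s i' else 0).
    by split=> // -[|i] //= /sS.
  by split=> //; rewrite path_weight_recl b10 subr0.
move=> [s sc [s0]]; rewrite path_weight_recl s0 b10 subr0 => sa.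
apply/(lt_supP _ hS).
have sI := schedule_itv sc (leqnn _); have [_ sS st] := sc.
exists (Zpath b n.+1 (s n.+1)).
  by exists (s n.+1) => //=; rewrite in_itv.
apply/ZP => //; exists (fun i => s i.+1); last by split.
split=> [|i|//]; last by move=> ?; apply: sS.
by have /andP[] := schedule_itv sc (isT : (1 <= n.+1)%N).
Qed.

Lemma lt_Y1pathP (R : realType) (t u : R) (f : R -> R) a :
    bounded_until t f -> 0 <= u <= t ->
  a < Y1path f u <-> exists2 s, 0 <= s <= u & a < f u - f s.
Proof.
move=> [M fM] /andP[u0 ut]; rewrite /Y1path.
have S0 : [set f s | s in `[0, u]] !=set0.
  by exists (f 0), 0 => //=; rewrite in_itv/= lexx.
rewrite ltrBrDl -ltrBrDr; split.
  move/(inf_lt S0) => [x [s /=]]; rewrite in_itv/= => sI <- ?.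
  by exists s => //; lra.
move=> [s sI sa]; apply: (@le_lt_trans _ _ (f s)); last by lra.
apply: ge_inf; last by exists s => //=; rewrite in_itv.
exists (- M) => x [v /=]; rewrite in_itv/= => /andP[v0 vu] <-.
have : `|f v| <= M by apply: fM; rewrite v0 (le_trans vu).
by rewrite ler_norml => /andP[].
Qed.

(** The infimum in Y_1 provides the free initial time s_0 of the schedule. *)
Lemma lt_YpathP (R : realType) (t : R) (b : nat -> R -> R) (n : nat) a :
    (1 <= n)%N -> 0 <= t ->
    (forall i, (1 <= i <= n)%N -> bounded_until t (b i)) ->
  a < Ypath b n t <->
  exists2 s, schedule t n s & s n = t /\ a < path_weight b n s.
Proof.
case: n => // n _ t0 bb.
have b1 := bb 1%N isT.
have bf : ubounded_until t (Y1path (b 1%N)).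
  have [M bM] := b1; exists (M + M) => u uI; rewrite leNgt; apply/negP.
  move/(lt_Y1pathP _ b1 uI) => [s /andP[s0 su]].
  have /andP[u0 ut] := uI.
  have : `|b 1%N s| <= M by apply: bM; rewrite s0 (le_trans su).
  have : `|b 1%N u| <= M by apply: bM.
  by rewrite !ler_norml => /andP[? ?] /andP[? ?]; lra.
have [_ YP] := lt_iterated_queueP bf bb (ltnSn n).
have tI : 0 <= t <= t by rewrite t0 lexx.
split.
  move/YP => /(_ tI) [s sc [sn]].
  have s0t := schedule_itv sc (leq0n _).
  have [s0 sS st] := sc.
  rewrite -ltrBlDr => /(lt_Y1pathP _ b1 s0t) [v /andP[v0 vs]].
  rewrite ltrBlDr => sa.
  exists (fun i => if i is i'.+1 then s i' else v).
    by split=> // -[|i] //= /sS.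
  by split=> //; rewrite path_weight_recl.
move=> [s sc [sn]]; rewrite path_weight_recl -ltrBlDr => sa.
have s1t := schedule_itv sc (isT : (1 <= n.+1)%N); have [s0 sS st] := sc.
apply/YP => //; exists (fun i => s i.+1).
  by split=> [|i|//]; [have /andP[] := s1t | by move=> ?; apply: sS].
split=> //; rewrite -ltrBlDr; apply/(lt_Y1pathP _ b1) => //.
by exists (s 0%N) => //; rewrite s0 sS.
Qed.

(** * Discrete last passage and its reversal *)

(** Up-right path form of the weight: row [i] of the array [x] of increments is
    summed over the steps of the grid between the times [c i] and [c i.+1]. *)
Definition grid_weight (R : realType) (n : nat) (c : nat -> nat)
    (x : nat -> nat -> R) : R :=
  \sum_(i < n) \sum_(c i <= k < c i.+1) x i k.

Definition grid_chain (n N : nat) (c : nat -> nat) : Prop :=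
  (forall i, (i < n)%N -> (c i <= c i.+1)%N) /\ (c n <= N)%N.

Lemma grid_chain_le n N c : grid_chain n N c ->
  forall i, (i <= n)%N -> (c i <= N)%N.
Proof.
move=> [cS cn] i le_in; rewrite -(subKn le_in).
elim: (n - i)%N (leq_subr i n) => [|k IH] kn; first by rewrite subn0.
apply: leq_trans (IH (ltnW kn)).
have -> : (n - k = (n - k.+1).+1)%N by lia.
by apply: cS; lia.
Qed.

Definition rev_chain (n N : nat) (c : nat -> nat) : nat -> nat :=
  fun i => (N - c (n - i))%N.

(** Rotation by a half turn of the n x N corner of [x]: rows and columns are both
    read backwards, that is, drivers in the opposite order and time reversed. *)
Definition rev_array (T : Type) (n N : nat) (x : nat -> nat -> T) :
  nat -> nat -> T := fun i k => x (n - i.+1)%N (N - k.+1)%N.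

Lemma rev_chain_grid n N c : grid_chain n N c ->
  grid_chain n N (rev_chain n N c).
Proof.
move=> [cS cn]; split; last exact: leq_subr.
move=> i lt_in; apply: leq_sub2l.
have -> : (n - i = (n - i.+1).+1)%N by lia.
by apply: cS; lia.
Qed.

Lemma sum_nat_reflect (V : zmodType) (F : nat -> V) m M N :
    (m <= M <= N)%N ->
  \sum_(N - M <= k < N - m) F (N - k.+1)%N = \sum_(m <= k < M) F k.
Proof.
move=> /andP[mM]; elim: M mM => [|M IH] mM MN.
  by move: mM; rewrite leqn0 => /eqP ->; rewrite !big_geq.
move: mM; rewrite leq_eqVlt => /predU1P[->|mM]; first by rewrite !big_geq.
rewrite big_nat_recr//= big_ltn; last by lia.
have -> : (N - M.+1).+1 = (N - M)%N by lia.
by rewrite IH// 1?ltnW// [RHS]addrC; congr (F _ + _); lia.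
Qed.

(** The discrete counterpart of time reversal: rotating both the array and the
    path only permutes the terms of the sum. *)
Lemma grid_weight_rev (R : realType) n N c (x : nat -> nat -> R) :
    grid_chain n N c ->
  grid_weight n (rev_chain n N c) (rev_array n N x) = grid_weight n c x.
Proof.
move=> cc; have [cS cn] := cc.
rewrite /grid_weight (reindex_inj rev_ord_inj)/=; apply: eq_bigr => i _.
have lt_in := ltn_ord i.
rewrite /rev_chain /rev_array.
have -> : (n - (n - i.+1) = i.+1)%N by lia.
have -> : (n - (n - i.+1).+1 = i)%N by lia.
rewrite sum_nat_reflect// cS//=.
exact: (grid_chain_le cc).
Qed.

Lemma grid_weight_eq (R : realType) n c c' (x : nat -> nat -> R) :
    (forall i, (i <= n)%N -> c i = c' i) ->
  grid_weight n c x = grid_weight n c' x.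
Proof.
move=> cc'; apply: eq_bigr => i _.
by rewrite !cc'// ltnW.
Qed.

Definition exceed_from_0 (R : realType) (n N : nat) (a : R) :
    set (nat -> nat -> R) :=
  [set x | exists2 c, grid_chain n N c & c 0%N = 0%N /\ a < grid_weight n c x].

Definition exceed_to_end (R : realType) (n N : nat) (a : R) :
    set (nat -> nat -> R) :=
  [set x | exists2 c, grid_chain n N c & c n = N /\ a < grid_weight n c x].

(** Reversal exchanges paths starting at 0 with paths ending at [N].  On chains
    below [N] the map [rev_chain] is an involution, hence both inclusions. *)
Lemma exceed_to_endE (R : realType) n N (a : R) :
  exceed_to_end n N a = rev_array n N @^-1` exceed_from_0 n N a.
Proof.
apply/seteqP; split=> x /= [c cc [ce ca]].
  exists (rev_chain n N c); first exact: rev_chain_grid.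
  by rewrite grid_weight_rev// /rev_chain subn0 ce subnn.
exists (rev_chain n N c); first exact: rev_chain_grid.
split; first by rewrite /rev_chain subnn ce subn0.
rewrite -(grid_weight_rev x (rev_chain_grid cc)).
rewrite (@grid_weight_eq _ _ _ c)// => i le_in.
by rewrite /rev_chain subKn// subKn// (grid_chain_le cc).
Qed.

(** * Dyadic approximation of schedules *)

Definition grid_point (R : realType) (t : R) (N k : nat) : R :=
  k%:R / N%:R * t.

(** Rounding down fixes both 0 and [t], so that rounded schedules keep the pinned
    endpoint, and it is monotone, so that they remain schedules. *)
Definition grid_floor (R : realType) (t : R) (N : nat) (u : R) : nat :=
  Num.truncn (u / t * N%:R).

Lemma grid_point_ge0 (R : realType) (t : R) N k : 0 < t ->
  0 <= grid_point t N k.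
Proof. by move=> t0; rewrite mulr_ge0 ?divr_ge0 ?ler0n// ltW. Qed.

Lemma grid_point_le (R : realType) (t : R) N k k' : 0 < t -> (k <= k')%N ->
  grid_point t N k <= grid_point t N k'.
Proof.
by move=> t0 kk'; rewrite ler_pM2r// ler_wpM2r ?invr_ge0 ?ler0n ?ler_nat.
Qed.

Lemma grid_point_last (R : realType) (t : R) N : (0 < N)%N ->
  grid_point t N N = t.
Proof. by move=> N0; rewrite /grid_point divff ?mul1r// pnatr_eq0 -lt0n. Qed.

Lemma grid_point_double (R : realType) (t : R) m k :
  grid_point t (2 ^ m.+1) k.*2 = grid_point t (2 ^ m) k.
Proof.
rewrite /grid_point -mul2n expnS !natrM invfM mulrACA divff ?mul1r//.
Qed.

Lemma grid_floorP (R : realType) (t : R) N u : 0 < t -> (0 < N)%N -> 0 <= u ->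
  grid_point t N (grid_floor t N u) <= u < grid_point t N (grid_floor t N u).+1.
Proof.
move=> t0 N0 u0; have N0' : 0 < N%:R :> R by rewrite ltr0n.
have /andP[h1 h2] : (grid_floor t N u)%:R <= u / t * N%:R
    < (grid_floor t N u).+1%:R.
  by apply: truncn_itv; rewrite mulr_ge0 ?divr_ge0// ltW.
rewrite /grid_point -ler_pdivlMr// -ltr_pdivrMr//.
by rewrite ler_pdivrMr// ltr_pdivlMr// h1 h2.
Qed.

Lemma grid_floor_le (R : realType) (t : R) N u v : 0 < t -> u <= v ->
  (grid_floor t N u <= grid_floor t N v)%N.
Proof.
by move=> t0 uv; apply: le_truncn; rewrite ler_wpM2r// ler_pM2r ?invr_gt0.
Qed.

Lemma grid_floor0 (R : realType) (t : R) N : grid_floor t N 0 = 0%N.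
Proof. by rewrite /grid_floor !mul0r; exact: (@natrK R 0%N). Qed.

Lemma grid_floor_last (R : realType) (t : R) N : 0 < t ->
  grid_floor t N t = N.
Proof. by move=> t0; rewrite /grid_floor divff ?gt_eqF// mul1r natrK. Qed.

Lemma cvg_grid_floor (R : realType) (t u : R) : 0 < t -> 0 <= u ->
  grid_point t (2 ^ m) (grid_floor t (2 ^ m) u) @[m --> \oo] --> u.
Proof.
move=> t0 u0; apply/cvgrPdist_lt => e e0.
have et0 : 0 < e / t by rewrite divr_gt0.
near=> m.
have N0 : (0 < 2 ^ m)%N by rewrite expn_gt0.
have /andP[h1 h2] := grid_floorP t0 N0 u0.
rewrite ger0_norm ?subr_ge0// ltrBlDl; apply: lt_le_trans h2 _.
rewrite /grid_point -[X in X%:R / _]addn1 natrD !mulrDl lerD2l.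
rewrite -ler_pdivlMr// natrX ltW//.
by near: m; exact: (near_infty_natSinv_expn_lt (PosNum et0)).
Unshelve. all: by end_near. Qed.

(** The weight depends on finitely many values of continuous paths. *)
Lemma cvg_path_weight_grid (R : realType) (t : R) (b : nat -> R -> R) n
    (s : nat -> R) : 0 < t ->
    (forall i, (1 <= i <= n)%N -> {within `[0, +oo[, continuous (b i)}) ->
    schedule t n s ->
  path_weight b n (fun i => grid_point t (2 ^ m) (grid_floor t (2 ^ m) (s i)))
    @[m --> \oo] --> path_weight b n s.
Proof.
move=> t0 cb sc.
have cvg_b i j : (i < n)%N -> (j <= n)%N ->
    b i.+1 (grid_point t (2 ^ m) (grid_floor t (2 ^ m) (s j))) @[m --> \oo]
      --> b i.+1 (s j).
  move=> lt_in le_jn; have /andP[sj0 _] := schedule_itv sc le_jn.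
  have /subspace_continuousP/(_ (s j)) := cb i.+1 lt_in.
  rewrite /= in_itv/= andbT => /(_ sj0) cbj.
  have cg := cvg_grid_floor t0 sj0.
  move=> A /cbj; rewrite /within/= => /cg.
  apply: (@filterS nat \oo) => m /=; apply.
  by rewrite in_itv/= andbT grid_point_ge0.
apply: cvg_big => [|i _]; first exact: add_continuous.
by apply: cvgB; apply: cvg_b => //; exact: ltnW.
Qed.

Definition grid_increments (R : realType) (t : R) (b : nat -> R -> R)
    (N i k : nat) : R :=
  b i.+1 (grid_point t N k.+1) - b i.+1 (grid_point t N k).

Lemma path_weight_grid (R : realType) (t : R) (b : nat -> R -> R) n N
    (c : nat -> nat) : grid_chain n N c ->
  path_weight b n (fun i => grid_point t N (c i)) =
  grid_weight n c (grid_increments t b N).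
Proof.
move=> [cS _]; apply: eq_bigr => i _.
by rewrite (telescope_sumr (fun k => b i.+1 (grid_point t N k)))// cS.
Qed.

Lemma grid_chain_schedule (R : realType) (t : R) n N c : 0 < t -> (0 < N)%N ->
  grid_chain n N c -> schedule t n (fun i => grid_point t N (c i)).
Proof.
move=> t0 N0 [cS cn]; split=> [|i /cS ?|]; first exact: grid_point_ge0.
  exact: grid_point_le.
by rewrite -[leRHS](grid_point_last t N0) grid_point_le.
Qed.

Lemma schedule_grid_chain (R : realType) (t : R) n N s : 0 < t ->
  schedule t n s -> grid_chain n N (fun i => grid_floor t N (s i)).
Proof.
move=> t0 [s0 sS sn]; split=> [i /sS|]; first exact: grid_floor_le.
by rewrite -[leqRHS](grid_floor_last N t0) grid_floor_le.
Qed.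

(** A strict lower bound on the weight survives a fine enough rounding. *)
Lemma exceed_from_0P (R : realType) (t a : R) (b : nat -> R -> R) n : 0 < t ->
    (forall i, (1 <= i <= n)%N -> {within `[0, +oo[, continuous (b i)}) ->
  (exists2 s, schedule t n s & s 0%N = 0 /\ a < path_weight b n s) <->
  exists m, exceed_from_0 n (2 ^ m) a (grid_increments t b (2 ^ m)).
Proof.
move=> t0 cb; split.
  move=> [s sc [s0 sa]].
  have [m _ /(_ m (leqnn m)) am] := cvgr_gt _ (cvg_path_weight_grid t0 cb sc) _ sa.
  exists m, (fun i => grid_floor t (2 ^ m) (s i)).
    exact: schedule_grid_chain.
  by rewrite s0 grid_floor0 -path_weight_grid//; exact: schedule_grid_chain.
move=> [m [c cc [c0 ca]]].
exists (fun i => grid_point t (2 ^ m) (c i)).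
  by apply: grid_chain_schedule; rewrite ?expn_gt0.
by rewrite c0 /grid_point !mul0r (path_weight_grid _ _ cc).
Qed.

Lemma exceed_to_endP (R : realType) (t a : R) (b : nat -> R -> R) n : 0 < t ->
    (forall i, (1 <= i <= n)%N -> {within `[0, +oo[, continuous (b i)}) ->
  (exists2 s, schedule t n s & s n = t /\ a < path_weight b n s) <->
  exists m, exceed_to_end n (2 ^ m) a (grid_increments t b (2 ^ m)).
Proof.
move=> t0 cb; split.
  move=> [s sc [sn sa]].
  have [m _ /(_ m (leqnn m)) am] := cvgr_gt _ (cvg_path_weight_grid t0 cb sc) _ sa.
  exists m, (fun i => grid_floor t (2 ^ m) (s i)).
    exact: schedule_grid_chain.
  by rewrite sn grid_floor_last// -path_weight_grid//; exact: schedule_grid_chain.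
move=> [m [c cc [cn ca]]].
exists (fun i => grid_point t (2 ^ m) (c i)).
  by apply: grid_chain_schedule; rewrite ?expn_gt0.
by rewrite cn grid_point_last ?expn_gt0// (path_weight_grid _ _ cc).
Qed.

(** The dyadic grids are nested: doubling the indices moves a chain to the next
    grid without changing its times. *)
Lemma grid_weight_double (R : realType) (t : R) (b : nat -> R -> R) n m c :
    grid_chain n (2 ^ m) c ->
  grid_chain n (2 ^ m.+1) (fun i => (c i).*2) /\
  grid_weight n (fun i => (c i).*2) (grid_increments t b (2 ^ m.+1)) =
  grid_weight n c (grid_increments t b (2 ^ m)).
Proof.
move=> cc; have [cS cn] := cc.
have cc2 : grid_chain n (2 ^ m.+1) (fun i => (c i).*2).
  split; first by move=> i /cS; rewrite leq_double.
  by rewrite expnS mul2n leq_double.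
split=> //; rewrite -!path_weight_grid//.
by apply: eq_bigr => i _; rewrite !grid_point_double.
Qed.

Lemma exceed_from_0_double (R : realType) (t a : R) (b : nat -> R -> R) n m :
  exceed_from_0 n (2 ^ m) a (grid_increments t b (2 ^ m)) ->
  exceed_from_0 n (2 ^ m.+1) a (grid_increments t b (2 ^ m.+1)).
Proof.
move=> [c cc [c0 ca]]; have [cc2 w2] := grid_weight_double t b cc.
by exists (fun i => (c i).*2) => //; rewrite c0 w2.
Qed.

Lemma exceed_to_end_double (R : realType) (t a : R) (b : nat -> R -> R) n m :
  exceed_to_end n (2 ^ m) a (grid_increments t b (2 ^ m)) ->
  exceed_to_end n (2 ^ m.+1) a (grid_increments t b (2 ^ m.+1)).
Proof.
move=> [c cc [cn ca]]; have [cc2 w2] := grid_weight_double t b cc.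
by exists (fun i => (c i).*2) => //; rewrite cn w2 expnS mul2n.
Qed.

(** * Joint law of an array of increments *)

Definition grid_rect (R : realType) (n N : nat) (A : nat -> nat -> set R) :
    set (nat -> nat -> R) :=
  [set x | forall i k, (i < n)%N -> (k < N)%N -> A i k (x i k)].

(** Rectangles constrain only the n x N corner of an array, so the sigma-algebra
    that they generate makes arrays indexed by all of nat * nat serve as points
    of a finite product of copies of [R]. *)
Definition grid_rects (R : realType) (n N : nat) :
    set (set (nat -> nat -> R)) :=
  [set S | exists2 A, (forall i k, measurable (A i k)) & S = grid_rect n N A].

Lemma grid_rects_setI (R : realType) n N : setI_closed (@grid_rects R n N).
Proof.
move=> _ _ [A mA ->] [B mB ->].
exists (fun i k => A i k `&` B i k).
  by move=> i k; exact: measurableI.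
apply/seteqP; split=> x /=.
  by move=> [xA xB] i k lt_in lt_kN; split; [exact: xA | exact: xB].
by move=> xAB; split=> i k lt_in lt_kN; have [] := xAB i k lt_in lt_kN.
Qed.

Lemma measurable_grid_entry (R : realType) n N i k : (i < n)%N -> (k < N)%N ->
  measurable_fun setT
    (fun x : g_sigma_algebraType (@grid_rects R n N) => x i k).
Proof.
move=> lt_in lt_kN _ B mB; rewrite setTI; apply: sub_sigma_algebra.
exists (fun i' k' => if (i' == i) && (k' == k) then B else setT).
  by move=> i' k'; case: ifP.
apply/seteqP; split=> x /=.
  by move=> xB i' k' _ _; case: ifP => // /andP[/eqP -> /eqP ->].
by move=> /(_ i k lt_in lt_kN); rewrite !eqxx.
Qed.

Lemma measurable_grid_weight_gt (R : realType) n N (c : nat -> nat) (a : R) :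
    grid_chain n N c ->
  <<s @grid_rects R n N >> [set x | a < grid_weight n c x].
Proof.
move=> cc.
pose T := g_sigma_algebraType (@grid_rects R n N).
have mw : measurable_fun setT (grid_weight n c : T -> R).
  apply: measurable_sum => i.
  pose h k (x : T) := if (k < N)%N then x i k else 0.
  rewrite (_ : (fun x : T => _) =
      (fun x : T => \sum_(c i <= k < c i.+1) h k x)).
    apply: measurable_sum => k; rewrite /h.
    have [kN|_] := ltnP k N; last exact: measurable_cst.
    exact: measurable_grid_entry.
  apply/funext => x; apply: eq_big_nat => k /andP[_ kc].
  by rewrite /h (leq_trans kc)// (grid_chain_le cc).
have := mw measurableT _ (measurable_itv `]a, +oo[).
rewrite setTI; congr (<<s _ >> _).
by apply/seteqP; split=> x /=; rewrite in_itv/= andbT.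
Qed.

(** Only the first n + 1 values of a chain matter, so the union over chains may
    be taken over the countable type of finite sequences. *)
Lemma measurable_exceed_from_0 (R : realType) n N (a : R) :
  <<s @grid_rects R n N >> (exceed_from_0 n N a).
Proof.
pose T := g_sigma_algebraType (@grid_rects R n N).
pose E (s : seq nat) : set T :=
  if `[< grid_chain n N (nth 0%N s) /\ nth 0%N s 0 = 0%N >]
  then [set x | a < grid_weight n (nth 0%N s) x] else set0.
have -> : exceed_from_0 n N a = \bigcup_s E s.
  apply/seteqP; split=> x.
    move=> [c [cS cn] [c0 ca]]; exists (mkseq c n.+1) => //.
    have cE i : (i <= n)%N -> nth 0%N (mkseq c n.+1) i = c i.
      by move=> le_in; rewrite nth_mkseq.
    rewrite /E; case: asboolP => /= [_|[]].
      by rewrite (grid_weight_eq _ cE).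
    split=> //; split=> [i lt_in|]; last by rewrite cE.
    by rewrite !cE ?cS// ltnW.
  move=> [s _]; rewrite /E; case: asboolP => //= -[cc c0] ca.
  by exists (nth 0%N s).
apply: (@countable_bigcupT_measurable _ T) => [|s]; first exact: countableP.
rewrite /E; case: asboolP => [[cc _]|_]; last exact: measurable0.
exact: measurable_grid_weight_gt.
Qed.

Lemma measurable_grid_map d (T : measurableType d) (R : realType) n N
    (X : T -> nat -> nat -> R) :
    (forall i k, (i < n)%N -> (k < N)%N ->
       measurable_fun setT (fun w => X w i k)) ->
  measurable_fun setT (X : T -> g_sigma_algebraType (@grid_rects R n N)).
Proof.
move=> mX.
apply: (@measurability _ _ T (g_sigma_algebraType (@grid_rects R n N)) setT X
  (@grid_rects R n N)) => //.
move=> _ [_ [A mA ->] <-]; rewrite setTI.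
rewrite (_ : _ @^-1` _ = \bigcap_(i in `I_n) \bigcap_(k in `I_N)
    ((fun w => X w i k) @^-1` A i k)); last first.
  apply/seteqP; split=> w /=.
    by move=> h i lt_in k lt_kN; exact: h.
  by move=> h i k lt_in lt_kN; exact: h.
apply: bigcap_measurableType => i lt_in.
apply: bigcap_measurableType => k lt_kN.
by rewrite -[X in measurable X]setTI; exact: mX.
Qed.

Lemma grid_law_unique d (T : measurableType d) (R : realType)
    (P : probability T R) n N (X Y : T -> nat -> nat -> R) :
    (forall i k, (i < n)%N -> (k < N)%N ->
       measurable_fun setT (fun w => X w i k)) ->
    (forall i k, (i < n)%N -> (k < N)%N ->
       measurable_fun setT (fun w => Y w i k)) ->
    (forall A, (forall i k, measurable (A i k)) ->
       P (X @^-1` grid_rect n N A) = P (Y @^-1` grid_rect n N A)) ->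
  forall U, <<s @grid_rects R n N >> U -> P (X @^-1` U) = P (Y @^-1` U).
Proof.
move=> /measurable_grid_map mX /measurable_grid_map mY XY U mU.
apply: (eq_law_of_pi_system (T' := g_sigma_algebraType (@grid_rects R n N))
  (G := @grid_rects R n N) (g := fun=> setT)) => //.
- exact: grid_rects_setI.
- by move=> _; exists (fun _ _ => setT) => //; apply/seteqP; split.
- by rewrite bigcup_const//; exists 0%N.
- by move=> _ [A mA ->]; exact: XY.
Qed.

(** * Increments of independent Brownian motions *)

Lemma mutually_independent_seq d (T : measurableType d) (R : realType)
    (P : probability T R) (I : choiceType) (D : set I) (F : I -> set (set T))
    (s : seq I) (A : I -> set T) :
    mutually_independent P D F -> uniq s -> (forall j, j \in s -> D j) ->
    (forall j, j \in s -> F j (A j)) ->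
  P (\bigcap_(j in [set` s]) A j) = (\prod_(j <- s) P (A j))%E.
Proof.
move=> ind us sD FA.
have JE j : (j \in [fset x | x in s]%fset) = (j \in s) by rewrite !inE.
have setJ : [set` [fset x | x in s]%fset] = [set` s].
  by apply/seteqP; split=> j /=; rewrite JE.
rewrite -setJ ind.
- apply: perm_big; apply: (uniq_perm (fset_uniq _) us).
  exact: JE.
- by move=> j /=; rewrite JE; exact: sD.
- by move=> j; rewrite JE; exact: FA.
Qed.

(** On a regular grid all the increments of one motion have the same law. *)
Lemma brownian_increments_prob d (T : measurableType d) (R : realType)
    (P : probability T R) (X : R -> {RV P >-> R}) (t : R) (N : nat)
    (A : nat -> set R) :
    standard_brownian_motion X -> 0 < t -> (forall k, measurable (A k)) ->
  P [set w | forall k, (k < N)%N ->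
      A k (X (grid_point t N k.+1) w - X (grid_point t N k) w)] =
  (\prod_(k < N) normal_prob 0 (Num.sqrt (t / N%:R)) (A k))%E.
Proof.
move=> bm t0 mA; case: N => [|N].
  by rewrite big_ord0 (_ : mkset _ = setT) ?probability_setT//; apply/seteqP.
set N' := N.+1; have N0 : 0 < N'%:R :> R by rewrite ltr0n.
pose tk := grid_point t N'.
have tkS k : tk k.+1 - tk k = t / N'%:R.
  by rewrite /tk /grid_point -natr1; field; rewrite gt_eqF.
have tk_lt k : tk k < tk k.+1 by rewrite -subr_gt0 tkS divr_gt0.
have tk0 k : 0 <= tk k by exact: grid_point_ge0.
have ind := bm_independent_increments bm (tk0 0%N)
  (fun k (_ : (k < N')%N) => tk_lt k).
pose E k := (fun w => X (tk k.+1) w - X (tk k) w) @^-1` A k.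
(* independence is available for families indexed by finite sequences *)
rewrite (_ : mkset _ = \bigcap_(k in [set` index_iota 0 N']) E k); last first.
  apply/seteqP; split=> w /= h k; first by rewrite /= mem_index_iota; exact: h.
  by move=> lt_kN; apply: h => /=; rewrite mem_index_iota.
rewrite (mutually_independent_seq ind) ?iota_uniq//.
- rewrite big_mkord; apply: eq_bigr => k _.
  have := bm_gaussian_increments bm (tk0 k) (tk_lt k) (mA k).
  by rewrite tkS => <-.
- by move=> k; rewrite mem_index_iota.
- by move=> k _; exists (A k) => //; rewrite setTI.
Qed.

(** Puts the constraint on all the increments of one motion inside the
    sigma-algebra of that motion, as mutual independence of the motions demands. *)
Lemma sigma_process_increments d (T : measurableType d) (R : realType)
    (P : probability T R) (X : R -> {RV P >-> R}) (t : R) (N : nat)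
    (A : nat -> set R) : 0 < t -> (forall k, measurable (A k)) ->
  sigma_process (fun u => X u : T -> R) [set w | forall k, (k < N)%N ->
      A k (X (grid_point t N k.+1) w - X (grid_point t N k) w)].
Proof.
move=> t0 mA; rewrite /sigma_process; set G := \bigcup_(_ in _) _.
pose T' := g_sigma_algebraType G.
have mX u : 0 <= u -> measurable_fun setT (X u : T' -> R).
  move=> u0 _ C mC; apply: sub_sigma_algebra; exists u.
    by rewrite /= in_itv/= u0.
  by exists C => //; rewrite setTI.
rewrite (_ : mkset _ = \bigcap_(k in `I_N)
    ((X (grid_point t N k.+1) : T' -> R) \- X (grid_point t N k)) @^-1` A k);
  last by apply/seteqP; split.
apply: (@bigcap_measurableType _ T') => k _.
rewrite -[X in measurable X]setTI.
by apply: measurable_realfun.measurable_funB => //;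
  apply: mX; exact: grid_point_ge0.
Qed.

(** Independence of the motions, then of the increments of each of them.  The
    product is symmetric in the entries of the array, which is what makes the
    joint law invariant under [rev_array]. *)
Lemma grid_increments_rect_prob d (T : measurableType d) (R : realType)
    (P : probability T R) (n : nat) (B : nat -> R -> {RV P >-> R})
    (t : R) (N : nat) (A : nat -> nat -> set R) :
    (forall j, (1 <= j <= n)%N -> standard_brownian_motion (B j)) ->
    mutually_independent P [set j | (1 <= j <= n)%N]
      (fun j => sigma_process (B j)) ->
    0 < t -> (forall i k, measurable (A i k)) ->
  P ((fun w => grid_increments t (fun j u => B j u w) N) @^-1` grid_rect n N A)
  = (\prod_(i < n) \prod_(k < N)
      normal_prob 0 (Num.sqrt (t / N%:R)) (A i k))%E.
Proof.
move=> hB ind t0 mA.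
pose E j := [set w | forall k, (k < N)%N ->
  A j.-1 k (B j (grid_point t N k.+1) w - B j (grid_point t N k) w)].
rewrite (_ : _ @^-1` _ = \bigcap_(j in [set` index_iota 1 n.+1]) E j).
  rewrite (mutually_independent_seq ind) ?iota_uniq//.
  - rewrite big_add1/= big_mkord; apply: eq_bigr => i _.
    by rewrite /E/= (brownian_increments_prob N (hB i.+1 (ltn_ord i))).
  - by move=> j; rewrite mem_index_iota.
  - by move=> j _; exact: sigma_process_increments.
apply/seteqP; split=> w /= h.
  move=> j /=; rewrite mem_index_iota; case: j => // i /= lt_in k.
  exact: h.
move=> i k lt_in lt_kN; apply: (h i.+1) => //=.
by rewrite mem_index_iota.
Qed.

(** * Equality in law *)

Lemma prob_exceed d (T : measurableType d) (R : realType)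
    (P : probability T R) (n : nat) (B : nat -> R -> {RV P >-> R})
    (t : R) (N : nat) (a : R) :
    (forall j, (1 <= j <= n)%N -> standard_brownian_motion (B j)) ->
    mutually_independent P [set j | (1 <= j <= n)%N]
      (fun j => sigma_process (B j)) ->
    0 < t ->
  let X w := grid_increments t (fun j u => B j u w) N in
  [/\ measurable (X @^-1` exceed_from_0 n N a),
      measurable (X @^-1` exceed_to_end n N a) &
      P (X @^-1` exceed_from_0 n N a) = P (X @^-1` exceed_to_end n N a)].
Proof.
move=> hB ind t0 X.
have mX i k : measurable_fun setT (fun w => X w i k).
  by apply: measurable_realfun.measurable_funB; exact: measurable_funPT.
have mXr i k : measurable_fun setT (fun w => rev_array n N (X w) i k).
  exact: mX.
have mZ := @measurable_exceed_from_0 R n N a.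
have XE : X @^-1` exceed_to_end n N a =
    (rev_array n N \o X) @^-1` exceed_from_0 n N a.
  by rewrite exceed_to_endE.
split.
- rewrite -[Y in measurable Y]setTI.
  exact: (measurable_grid_map (n := n) (N := N) (fun i k _ _ => mX i k)).
- rewrite XE -[Y in measurable Y]setTI.
  exact: (measurable_grid_map (n := n) (N := N) (fun i k _ _ => mXr i k)).
rewrite XE.
apply: (@grid_law_unique _ T R P n N X (rev_array n N \o X)
  (fun i k _ _ => mX i k) (fun i k _ _ => mXr i k) _ _ mZ) => A mA.
rewrite (_ : (_ \o X) @^-1` _ = X @^-1` grid_rect n N (rev_array n N A)).
  have mAr i k : measurable (rev_array n N A i k) by exact: mA.
  rewrite /X. rewrite (grid_increments_rect_prob N hB ind t0 mA).
  rewrite (grid_increments_rect_prob N hB ind t0 mAr).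
  rewrite [RHS](reindex_inj rev_ord_inj)/=.
  apply: eq_bigr => i _; rewrite [RHS](reindex_inj rev_ord_inj)/=.
  by apply: eq_bigr => k _; rewrite /rev_array !subnSK// !subKn// ltnW.
have revK m l : (l < m)%N -> (m - (m - l.+1).+1)%N = l by lia.
apply/seteqP; split=> w /= h i k lt_in lt_kN.
all: have lt_in' : (n - i.+1 < n)%N by lia.
all: have lt_kN' : (N - k.+1 < N)%N by lia.
all: by have := h _ _ lt_in' lt_kN'; rewrite /rev_array !revK.
Qed.

Lemma bigcup_prob_eq d (T : measurableType d) (R : realType)
    (P : probability T R) (E F : nat -> set T) :
    (forall m, measurable (E m)) -> (forall m, measurable (F m)) ->
    (forall m, E m `<=` E m.+1) -> (forall m, F m `<=` F m.+1) ->
    (forall m, P (E m) = P (F m)) ->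
  P (\bigcup_m E m) = P (\bigcup_m F m).
Proof.
move=> mE mF ndE ndF EF.
have nd (S : nat -> set T) : (forall m, S m `<=` S m.+1) -> nondecreasing_seq S.
  by move=> SS; apply/nondecreasing_seqP => m; exact/subsetPset/SS.
have cE := nondecreasing_cvg_mu (mu := P) mE (bigcupT_measurable _ mE) (nd _ ndE).
have cF := nondecreasing_cvg_mu (mu := P) mF (bigcupT_measurable _ mF) (nd _ ndF).
rewrite (_ : P \o F = P \o E) in cF;
  last by apply/funext => m /=; rewrite EF.
exact: cvg_unique cE cF.
Qed.

(** The time has to be positive for the grid points to be distinct. *)
Lemma eq_in_law_pos_time (d : measure_display) (T : measurableType d)
    (R : realType) (P : probability T R) (n : nat) (hn : (1 <= n)%N)
    (B : nat -> R -> {RV P >-> R})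
    (hB : forall j, (1 <= j <= n)%N -> standard_brownian_motion (B j))
    (hind : mutually_independent P [set j | (1 <= j <= n)%N]
              (fun j => sigma_process (B j)))
    (t : R) (t0 : 0 < t) :
  eq_in_law P
    (fun w => sup [set Zpath (fun j u => B j u w) n s | s in `[0, t]])
    (fun w => Ypath (fun j u => B j u w) n t).
Proof.
pose b w j u := B j u w.
have cb w i : (1 <= i <= n)%N -> {within `[0, +oo[, continuous (b w i)}.
  by move=> /hB /bm_continuous; exact.
have bb w i : (1 <= i <= n)%N -> bounded_until t (b w i).
  by move=> iI; apply: continuous_bounded_until; [exact: ltW | exact: cb].
have b10 w : b w 1%N 0 = 0 by apply: bm_start; exact: hB.
pose X m w := grid_increments t (b w) (2 ^ m).
pose E a m := X m @^-1` exceed_from_0 n (2 ^ m) a.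
pose F a m := X m @^-1` exceed_to_end n (2 ^ m) a.
have ZE a : [set w | a < sup [set Zpath (b w) n s | s in `[0, t]]] =
    \bigcup_m E a m.
  apply/seteqP; split=> w /=.
    move/(lt_sup_ZpathP _ hn (ltW t0) (bb w) (b10 w)).
    by move/(exceed_from_0P _ t0 (cb w)) => [m ?]; exists m.
  move=> [m _ ?]; apply/(lt_sup_ZpathP _ hn (ltW t0) (bb w) (b10 w)).
  by apply/(exceed_from_0P _ t0 (cb w)); exists m.
have YF a : [set w | a < Ypath (b w) n t] = \bigcup_m F a m.
  apply/seteqP; split=> w /=.
    move/(lt_YpathP _ hn (ltW t0) (bb w)).
    by move/(exceed_to_endP _ t0 (cb w)) => [m ?]; exists m.
  move=> [m _ ?]; apply/(lt_YpathP _ hn (ltW t0) (bb w)).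
  by apply/(exceed_to_endP _ t0 (cb w)); exists m.
have EF a m := prob_exceed (2 ^ m) a hB hind t0.
have mE a m : measurable (E a m) by have [] := EF a m.
have mF a m : measurable (F a m) by have [] := EF a m.
apply: eq_law_of_gt => a.
- by rewrite ZE; exact: bigcupT_measurable.
- by rewrite YF; exact: bigcupT_measurable.
rewrite ZE YF; apply: bigcup_prob_eq => // m.
- by move=> w; exact: exceed_from_0_double.
- by move=> w; exact: exceed_to_end_double.
- by have [] := EF a m.
Qed.

Theorem proposition3 (d : measure_display) (T : measurableType d)
    (R : realType) (P : probability T R) (n : nat) (hn : (1 <= n)%N)
    (B : nat -> R -> {RV P >-> R})
    (hB : forall j, (1 <= j <= n)%N -> standard_brownian_motion (B j))
    (hind : mutually_independent P [set j | (1 <= j <= n)%N]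
              (fun j => sigma_process (B j)))
    (t : R) (ht : 0 <= t) :
  eq_in_law P
    (fun w => sup [set Zpath (fun j u => B j u w) n s | s in `[0, t]])
    (fun w => Ypath (fun j u => B j u w) n t).
Proof.
move: ht; rewrite le_eqVlt => /predU1P[t0|]; last exact: eq_in_law_pos_time.
(* At time 0 all schedules are constantly 0, and both variables vanish. *)
rewrite -{t}t0.
pose b w j u := B j u w.
have bb w i : (1 <= i <= n)%N -> bounded_until 0 (b w i).
  by move=> /hB/bm_continuous cB; exact: continuous_bounded_until (cB w).
have b10 w : b w 1%N 0 = 0 by apply: bm_start; exact: hB.
have w0 w s : schedule 0 n s -> path_weight (b w) n s = 0.
  move=> sc; rewrite /path_weight big1// => i _.
  have s0 j : (j <= n)%N -> s j = 0.
    by move=> /(schedule_itv sc); rewrite -eq_le => /eqP.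
  by rewrite !s0 ?subrr// ltnW.
have sc0 : schedule 0 n (fun=> 0 : R) by split=> // i _; exact: lexx.
have lt_eq0 (x : R) : (forall a, a < x <-> a < 0) -> x = 0.
  move=> h; apply: le_anti; apply/andP; split; rewrite leNgt; apply/negP.
    by move/h; rewrite ltxx.
  by move/(h x).2; rewrite ltxx.
have Z0 w : sup [set Zpath (b w) n s | s in `[0, 0]] = 0.
  apply: lt_eq0 => a; split.
    by move=> /(lt_sup_ZpathP _ hn (lexx 0) (bb w) (b10 w))[s /w0 -> []].
  move=> a0; apply/(lt_sup_ZpathP _ hn (lexx 0) (bb w) (b10 w)).
  by exists (fun=> 0) => //; rewrite w0.
have Y0 w : Ypath (b w) n 0 = 0.
  apply: lt_eq0 => a; split.
    by move=> /(lt_YpathP _ hn (lexx 0) (bb w))[s /w0 -> []].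
  move=> a0; apply/(lt_YpathP _ hn (lexx 0) (bb w)).
  by exists (fun=> 0) => //; rewrite w0.
rewrite (funext Z0) (funext Y0); split => //; exact: measurable_cst.
Qed.
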